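(* Let $\mathcal{F}$ be a type of algebras and let $\mathcal{F}\text{-}\mathbf{Alg}$ be the variety (category) of all (unordered) algebras of type $\mathcal{F}$ with all homomorphisms. Then every epimorphism in $\mathcal{F}\text{-}\mathbf{Alg}$ is surjective.
   Context: An epimorphism is a right-cancellative homomorphism in the category $\mathcal{F}\text{-}\mathbf{Alg}$. *)

(* Defs.v *)
From mathcomp Require Import all_boot.
Set Implicit Arguments.
Unset Strict Implicit.
Unset Printing Implicit Defensive.

Record algebra_type := AlgebraType {
  op_symbol : Type;
  arity : op_symbol -> nat
}.

(* The carrier may be empty. Requiring nonempty carriers yields the same
   epimorphisms between nonempty algebras, since an algebra receiving a map
   from a nonempty one is itself nonempty. *)
Record algebra (F : algebra_type) := Algebra {
  carrier :> Type;
  op : forall s : op_symbol F, (arity s).-tuple carrier -> carrier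
}.

Definition is_homomorphism (F : algebra_type) (A B : algebra F) (f : A -> B) :=
  forall (s : op_symbol F) (t : (arity s).-tuple A),
    f (op t) = op (map_tuple f t).

Record homomorphism (F : algebra_type) (A B : algebra F) := Homomorphism {
  hom_fun :> A -> B;
  hom_op : is_homomorphism hom_fun
}.

(* Homomorphisms are compared as functions, i.e. pointwise. *)
Definition epimorphism (F : algebra_type) (A B : algebra F)
    (f : homomorphism A B) : Prop :=
  forall (C : algebra F) (g h : homomorphism B C),
    g \o f =1 h \o f -> g =1 h.

Definition surjective (X Y : Type) (f : X -> Y) : Prop :=
  forall y : Y, exists x : X, f x = y.

(* Main.v *)
Require Import Defs.
From mathcomp Require Import all_boot.
From mathcomp Require Import boolp.

(** Glue two copies of [B] along the image [f(A)], which is a subalgebra: the two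
    inclusions of [B] in the amalgam agree exactly on [f(A)], so right
    cancellation forces [f(A) = B]. The gluing is realised without a quotient,
    on [B * bool]: a pair [(b, true)] stands for [b] in the second copy, and the
    flag of a result is reset to [false] as soon as it lies in [f(A)]; the pairs
    [(b, true)] with [b] in [f(A)] are harmless junk. *)

Set Implicit Arguments.
Unset Strict Implicit.
Unset Printing Implicit Defensive.

Section Amalgam.
Variables (F : algebra_type) (A B : algebra F) (f : homomorphism A B).

Definition in_image (b : B) : bool := `[< exists a, f a = b >].

Lemma in_image_op (s : op_symbol F) (t : (arity s).-tuple B) :
  all in_image t -> in_image (op t).
Proof.
move=> /all_tnthP t_im.
have [u fu] := choice (fun i => asboolW (t_im i)).
apply/asboolP; exists (op (mktuple u)); rewrite (hom_op f); congr op.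
by apply: eq_from_tnth => i; rewrite tnth_map tnth_mktuple.
Qed.

(** No identities constrain the operations, so tuples mixing both copies may go anywhere; here one
    flagged entry sends the result to the second copy. *)
Definition amalgam : algebra F :=
  @Algebra F (B * bool)%type (fun s t =>
    let b := op (map_tuple fst t) in (b, has snd t && ~~ in_image b)).

Definition inl_amalgam (b : B) : amalgam := (b, false).
Definition inr_amalgam (b : B) : amalgam := (b, ~~ in_image b).

Lemma inl_amalgam_hom : is_homomorphism inl_amalgam.
Proof.
move=> s t; rewrite /inl_amalgam /= has_map has_pred0 /=.
by congr (op _, _); apply: eq_from_tnth => i; rewrite !tnth_map.
Qed.

Lemma inr_amalgam_hom : is_homomorphism inr_amalgam.
Proof.
move=> s t; rewrite /inr_amalgam /=.
have -> : map_tuple fst (map_tuple inr_amalgam t) = t.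
  by apply: eq_from_tnth => i; rewrite !tnth_map.
congr (_, _); rewrite has_map (eq_has (a2 := predC in_image)) // has_predC.
(* If all entries lie in the image, vacuously so for constants, the result does too and both flags
   are [false]; otherwise some entry is flagged. *)
by case: (boolP (all _ _)) => [/in_image_op ->|].
Qed.

End Amalgam.

Theorem corollary4 (F : algebra_type) (A B : algebra F)
    (f : homomorphism A B) (hf : epimorphism f) : surjective f.
Proof.
move=> b; apply/asboolP.
have agree : Homomorphism (inl_amalgam_hom f) \o f
    =1 Homomorphism (@inr_amalgam_hom _ _ _ f) \o f.
  move=> a; congr (_, _); apply/esym/negbTE; rewrite negbK.
  by apply/asboolP; exists a.
(* Compare flags at [b]: [false] on the left, [~~ in_image b] on the right. *)
by have [/esym/negbFE] := hf _ _ _ agree b.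
Qed.
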